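(* Let $\mathcal{H}$ be a real Hilbert space, let $m$ be a positive integer, let $T:\mathcal{H}\to\mathcal{H}$ be a continuous linear self-adjoint operator, let $T_1,\dots,T_m:\mathcal{H}\to\mathcal{H}$ be positive semidefinite continuous linear self-adjoint operators, and let $c,c_1,\dots,c_m\in\mathcal{H}$, $\alpha_1,\dots,\alpha_m\in\mathbb{R}$. Put $f(x)=\frac12\langle x,Tx\rangle+\langle c,x\rangle$, $g_i(x)=\frac12\langle x,T_ix\rangle+\langle c_i,x\rangle+\alpha_i$ and $F=\{x\in\mathcal{H}\mid g_i(x)\leqslant 0,\ i=1,\dots,m\}$. Suppose that: (i) $T$ and $T_i$ ($i=1,\dots,m$) are compact operators with closed range; (ii) $F$ is nonempty and $f$ is bounded from below over $F$; (iii) condition (A) holds: for every $v\in 0^+F$ with $\langle v,Tv\rangle=0$ one has $\langle c_i,v\rangle=0$ for all $i\in I_1$, where $I_1=\{i\in\{1,\dots,m\}\mid T_i\neq 0\}$ (the condition being vacuously satisfied if $I_1=\emptyset$). Then the problem of minimizing $f(x)$ subject to $x\in F$ has a solution, i.e. there is $\bar x\in F$ with $f(\bar x)\leqslant f(x)$ for all $x\in F$.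
   Context: A continuous linear self-adjoint operator $S$ on $\mathcal{H}$ is positive semidefinite if $\langle x,Sx\rangle\geqslant 0$ for all $x\in\mathcal{H}$. A linear operator on $\mathcal{H}$ is compact if it transforms every weakly convergent sequence into a strongly convergent sequence. The recession cone of a nonempty closed convex set $X\subset\mathcal{H}$ is $0^+X=\{v\in\mathcal{H}\mid x+tv\in X\ \ \forall x\in X,\ \forall t\geqslant 0\}$. *)

(* Defs.v *)
From HB Require Import structures.
From mathcomp Require Import all_boot all_order all_algebra.
From mathcomp Require Import all_classical all_reals topology normedtype sequences.

Set Implicit Arguments.
Unset Strict Implicit.
Unset Printing Implicit Defensive.
Import Order.TTheory GRing.Theory Num.Theory.
Import numFieldNormedType.Exports.
Local Open Scope classical_set_scope.
Local Open Scope ring_scope.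

Section HilbertSpace.
Variables (R : realType) (H : completeNormedModType R).
Variable ip : {dot H for (@idfun R)}.

(* Together with the completeness of H, this makes (H, ip) a real Hilbert
   space: the norm of H is the one derived from ip. *)
Definition inner_product_norm := forall x : H, `|x| = Num.sqrt (ip x x).

Definition self_adjoint (A : H -> H) := forall x y : H, ip (A x) y = ip x (A y).

Definition positive_semidefinite (A : H -> H) := forall x : H, 0 <= ip x (A x).

Definition recession_cone (X : set H) : set H :=
  [set v | forall x, X x -> forall t : R, 0 <= t -> X (x + t *: v)].

Definition condition_A (T : H -> H) (F : set H) (m : nat) (A : 'I_m -> H -> H)
    (b : 'I_m -> H) :=
  let I1 := [set i | A i <> \0] in
  forall v, recession_cone F v -> ip v (T v) = 0 ->
  forall i, I1 i -> ip (b i) v = 0.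

End HilbertSpace.

Section CompactOperator.
Variables (R : realType) (H : normedModType R).

Definition weakly_cvg (u : nat -> H) (x : H) :=
  forall phi : {scalar H}, continuous phi -> phi (u n) @[n --> \oo] --> phi x.

Definition compact_operator (A : H -> H) :=
  forall (u : nat -> H) (x : H), weakly_cvg u x -> cvg (A (u n) @[n --> \oo]).

End CompactOperator.

(* Main.v *)
Require Import Defs.
From HB Require Import structures.
From mathcomp Require Import all_boot all_order all_algebra.
From mathcomp Require Import all_classical all_reals topology normedtype sequences.
From mathcomp Require Import interval_inference derive ring lra.

Set Implicit Arguments.
Unset Strict Implicit.
Unset Printing Implicit Defensive.
Import Order.TTheory GRing.Theory Num.Theory.
Import numFieldNormedType.Exports.
Local Open Scope classical_set_scope.
Local Open Scope ring_scope.

(** The operators have finite rank, so the problem is a finite-dimensional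
    one, and points of F that escape to infinity at bounded level can be
    pulled back towards 0 without raising f.

    Finite rank ([finite_rank]). Otherwise the range of T would contain an
    orthonormal sequence (e_n). By Bessel's inequality it tends weakly to 0,
    so T e_n tends strongly to 0, and along a subsequence |T e_k| <= 4^-k. The
    vector y = sum_k 2^-k e_k lies in the closed range of T, say y = T z, and
    2^-k = <y, e_k> = <z, T e_k> <= 4^-k |z| for all k, which is absurd. Let P
    be the orthogonal projection onto a finite-dimensional space containing
    the ranges of T and the T_i, c and the c_i. Then f (P x) = f x and P
    maps F into itself ([common_finite_dimensional_support]); moreover closed
    balls of the range of P are compact ([compact_proj_ball]).

    Escape to infinity ([far_least_norm_point]). If f had no minimizer on F, a
    minimizer of f over F and a ball of the range of P would be beaten by some
    point of F. A point of least norm among those of F at or below the level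
    so reached lies outside the ball. This gives x_n in F with f (x_n) bounded
    above and |x_n| > n such that no point of F at level at most f (x_n) is
    shorter than x_n; by compactness x_n / |x_n| tends to some v along a
    subsequence.

    Contradiction ([escaping_sequence_descends]). Dividing g_i (x_n) <= 0 by
    |x_n|^2 and by |x_n| gives T_i v = 0 and <c_i, v> <= 0, hence v is a
    recession direction of F. Dividing f (x_n) <= B by |x_n|^2 gives <v, T v>
    <= 0, and since f is bounded below on the ray x_n + t v, one gets <v, T v>
    = 0 and <T x_n + c, v> >= 0. Therefore f (x_n - v) <= f (x_n). By
    condition (A), subtracting v leaves the constraints with T_i <> 0
    unchanged; the affine ones are unchanged as well, or have <c_i, v> < 0 and
    are then arbitrarily slack at x_n. So x_n - v is in F for large n, while
    |x_n - v| < |x_n|: this contradicts the choice of x_n. *)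

(** * Real inner products *)

Section InnerProduct.
Variables (R : realType) (H : completeNormedModType R).
Variable ip : {dot H for (@idfun R)}.
Hypothesis ip_norm : inner_product_norm ip.

Lemma ipC x y : ip x y = ip y x.
Proof. by rewrite hermC expr0 mul1r. Qed.

Lemma ipZl a x y : ip (a *: x) y = a * ip x y.
Proof. exact: linearZl_LR. Qed.

Lemma ipZr a x y : ip x (a *: y) = a * ip x y.
Proof. by rewrite ipC ipZl ipC. Qed.

Lemma ipDl x y z : ip (x + y) z = ip x z + ip y z.
Proof. exact: linearDl. Qed.

Lemma ipBl x y z : ip (x - y) z = ip x z - ip y z.
Proof. exact: linearBl. Qed.

Lemma ipDr x y z : ip z (x + y) = ip z x + ip z y.
Proof. exact: linearDr. Qed.

Lemma ipBr x y z : ip z (x - y) = ip z x - ip z y.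
Proof. exact: linearBr. Qed.

Lemma ip0l x : ip 0 x = 0. Proof. exact: linear0l. Qed.

Lemma ip0r x : ip x 0 = 0. Proof. exact: linear0r. Qed.

Lemma ip_suml (I : Type) (r : seq I) (F : I -> H) x :
  ip (\sum_(i <- r) F i) x = \sum_(i <- r) ip (F i) x.
Proof. exact: linear_sumlz. Qed.

Lemma ip_sumr (I : Type) (r : seq I) (F : I -> H) x :
  ip x (\sum_(i <- r) F i) = \sum_(i <- r) ip x (F i).
Proof. exact: linear_sumr. Qed.

Lemma ipxx_ge0 x : 0 <= ip x x.
Proof.
have [->|x0] := eqVneq x 0; first by rewrite ip0l.
exact/ltW/neq0_dnorm_gt0.
Qed.

Lemma ipxx_eq0 x : ip x x = 0 -> x = 0.
Proof.
move=> xx0; apply: contraPeq xx0 => /(neq0_dnorm_gt0 (s := ip)).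
by move=> /gt_eqF/eqP.
Qed.

Lemma ipxx x : ip x x = `|x| ^+ 2.
Proof. by rewrite ip_norm sqr_sqrtr// ipxx_ge0. Qed.

Lemma polarization x y :
  ip x y = 2^-1 * (`|x + y| ^+ 2 - `|x| ^+ 2 - `|y| ^+ 2).
Proof. by rewrite -!ipxx ipDl !ipDr (ipC y x); field. Qed.

(** The triangle inequality of the norm, read through polarization. *)
Lemma cauchy_schwarz x y : `|ip x y| <= `|x| * `|y|.
Proof.
have le_ip u v : ip u v <= `|u| * `|v|.
  have := ler_normD u v; have := normr_ge0 (u + v).
  have := normr_ge0 u; have := normr_ge0 v.
  by rewrite polarization; nra.
rewrite ler_norml le_ip andbT lerNl -mulN1r -ipZl scaleN1r -(normrN x).
exact: le_ip.
Qed.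

(** Polarization reduces the continuity of the inner product to that of the
    norm. *)
Lemma cvg_ip (I : Type) (G : set_system I) {GG : Filter G} (u w : I -> H) a b :
  u @ G --> a -> w @ G --> b -> ip (u i) (w i) @[i --> G] --> ip a b.
Proof.
move=> ua wb; rewrite polarization.
under eq_fun do rewrite polarization.
apply: cvgMr; apply: cvgB; first apply: cvgB.
- by apply: cvgM; apply: cvg_norm; apply: cvgD.
- by apply: cvgM; apply: cvg_norm.
- by apply: cvgM; apply: cvg_norm.
Qed.

End InnerProduct.

(** * Orthonormal families and projections *)

Section Projection.
Variables (R : realType) (H : completeNormedModType R).
Variable ip : {dot H for (@idfun R)}.
Hypothesis ip_norm : inner_product_norm ip.

(** Recursion on the head, since the families are extended one vector at a
    time. *)
Fixpoint orthonormal (L : seq H) : Prop :=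
  if L is e :: L' then
    [/\ ip e e = 1, forall x, x \in L' -> ip e x = 0 & orthonormal L']
  else True.

(** For an orthonormal L this is the orthogonal projection onto the span
    of L, which is thus represented as the set of fixed points of [proj L]. *)
Definition proj (L : seq H) (x : H) : H := \sum_(e <- L) ip e x *: e.

Lemma proj_cons e L x : proj (e :: L) x = ip e x *: e + proj L x.
Proof. by rewrite /proj big_cons. Qed.

Lemma proj_sum L (I : Type) (r : seq I) (a : I -> R) (w : I -> H) :
  proj L (\sum_(i <- r) a i *: w i) = \sum_(i <- r) a i *: proj L (w i).
Proof.
rewrite /proj; under eq_bigr do rewrite ip_sumr scaler_suml.
rewrite exchange_big/=; apply: eq_bigr => i _.
by rewrite scaler_sumr; apply: eq_bigr => e _; rewrite ipZr scalerA.
Qed.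

Lemma ip_proj_sym L x y : ip (proj L x) y = ip x (proj L y).
Proof.
rewrite /proj ip_suml ip_sumr; apply: eq_bigr => e _.
by rewrite ipZl ipZr (ipC ip x e) mulrC.
Qed.

Lemma proj_orthogonal L x : (forall e, e \in L -> ip e x = 0) -> proj L x = 0.
Proof.
by move=> Lx; rewrite /proj big_seq big1// => e eL; rewrite Lx// scale0r.
Qed.

Lemma proj_mem L e : orthonormal L -> e \in L -> proj L e = e.
Proof.
elim: L => [//|e0 L IH] /= [e01 e0L oL]; rewrite inE proj_cons.
move=> /predU1P[->|eL].
  rewrite e01 scale1r proj_orthogonal ?addr0// => x xL.
  by rewrite ipC e0L.
by rewrite e0L// scale0r add0r IH.
Qed.

Lemma proj_fixed L L' x : (forall e, e \in L' -> proj L e = e) ->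
  proj L (proj L' x) = proj L' x.
Proof.
move=> LL'; rewrite {2}/proj proj_sum /proj big_seq [RHS]big_seq.
by apply: eq_bigr => e eL'; rewrite -/(proj L e) LL'.
Qed.

Lemma proj_idem L x : orthonormal L -> proj L (proj L x) = proj L x.
Proof. by move=> oL; apply: proj_fixed => e; exact: proj_mem. Qed.

Lemma norm_proj_le L x : orthonormal L -> `|proj L x| <= `|x|.
Proof.
move=> oL; have := cauchy_schwarz ip_norm x (proj L x).
have -> : ip x (proj L x) = ip (proj L x) (proj L x).
  by rewrite ip_proj_sym proj_idem.
rewrite (ipxx ip_norm) ger0_norm ?exprn_ge0//.
have := normr_ge0 x; have := normr_ge0 (proj L x).
by nra.
Qed.

(** One Gram-Schmidt step. It serves both to span a given finite family and,
    below, to build an infinite orthonormal sequence one term at a time. *)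
Lemma orthonormal_extend L w (r := w - proj L w) : orthonormal L -> r != 0 ->
  orthonormal (`|r|^-1 *: r :: L) /\ proj (`|r|^-1 *: r :: L) w = w.
Proof.
move=> oL r0; have nr0 : `|r| != 0 by rewrite normr_eq0.
have rproj z : ip r (proj L z) = 0.
  by rewrite /r ipBl ip_proj_sym proj_idem// subrr.
have rw : ip r w = `|r| ^+ 2.
  by rewrite -(ipxx ip_norm) {3}/r ipBr rproj subr0.
split.
  split=> //.
    by rewrite ipZl ipZr (ipxx ip_norm); field.
  by move=> x xL; rewrite ipZl -(proj_mem oL xL) rproj mulr0.
rewrite proj_cons ipZl rw scalerA.
have -> : `|r|^-1 * `|r| ^+ 2 * `|r|^-1 = 1 by field.
by rewrite scale1r subrK.
Qed.

Lemma gram_schmidt (W : seq H) :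
  exists2 L, orthonormal L & forall w, w \in W -> proj L w = w.
Proof.
elim: W => [|w W [L oL LW]]; first by exists [::].
have [/eqP|r0] := eqVneq (w - proj L w) 0.
  rewrite subr_eq0 => /eqP wL; exists L => // z.
  by rewrite inE => /predU1P[->|/LW].
have [oeL eLw] := orthonormal_extend oL r0.
eexists; first exact: oeL.
move=> z; rewrite inE => /predU1P[->//|zW].
rewrite proj_cons ipZl -[in ip _ z](LW _ zW) ipBl ip_proj_sym proj_idem//.
by rewrite subrr mulr0 scale0r add0r LW.
Qed.

Lemma orthonormal_unit L e : orthonormal L -> e \in L -> ip e e = 1.
Proof.
elim: L => [//|e0 L IH] /= [e01 _ oL]; rewrite inE => /predU1P[->//|].
exact: IH.
Qed.

Lemma continuous_proj L : continuous (proj L).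
Proof.
elim: L => [|e L IH] x.
  rewrite (_ : proj [::] = fun=> 0); first exact: cvg_cst.
  by apply/funext => y; rewrite /proj big_nil.
rewrite (_ : proj (e :: L) = fun y => ip e y *: e + proj L y); last first.
  by apply/funext => y; rewrite proj_cons.
apply: cvgD (IH x); apply: cvgZ; last exact: cvg_cst.
by apply: (cvg_ip ip_norm) => //; exact: cvg_cst.
Qed.

(** The compact sets are built one direction at a time: the combinations of
    e :: L with coefficients in [- r, r] are the image of a product of two
    compacts under the map (a, x) |-> a *: e + x. *)
Lemma compact_proj_ball L (r : R) : orthonormal L ->
  compact [set x | proj L x = x /\ `|x| <= r].
Proof.
move=> oL.
have [K cK KL] : exists2 K : set H, compact K & forall a : H -> R,
    (forall e, e \in L -> `|a e| <= r) -> K (\sum_(e <- L) a e *: e).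
  elim: {oL} L => [|e L [K cK KL]].
    exists [set 0]; first exact: compact_set1.
    by move=> a _; rewrite big_nil.
  exists ((fun z : R^o * H => z.1 *: e + z.2) @` (`[- r, r] `*` K)); last first.
    move=> a ar; rewrite big_cons; exists (a e, \sum_(j <- L) a j *: j) => //.
    split=> /=; first by rewrite in_itv/= -ler_norml ar// mem_head.
    by apply: KL => j jL; rewrite ar// inE jL orbT.
  apply: continuous_compact; last first.
    exact/compact_setX/cK/segment_compact.
  apply: continuous_subspaceT => z.
  apply: cvgD; last exact: cvg_snd.
  apply: cvgZ; [exact: cvg_fst|exact: cvg_cst].
apply: subclosed_compact cK _.
  rewrite (_ : [set x | _] = (fun x => `|proj L x - x|) @^-1` [set y | y <= 0]
      `&` (fun x => `|x|) @^-1` [set y | y <= r]); last first.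
    apply/seteqP; split=> x /= [Lx xr]; split=> //.
      by rewrite Lx subrr normr0.
    by apply/eqP; rewrite -subr_eq0 -normr_le0.
  apply: closedI; apply: preimage_closed;
    [|exact: closed_le| |exact: closed_le].
    move=> x _; apply: cvg_norm; apply: cvgB => //; exact: continuous_proj.
  by move=> x _; exact: norm_continuous.
move=> x [xL xr].
rewrite -xL; apply: KL => e eL.
apply: (le_trans _ xr).
rewrite (le_trans (cauchy_schwarz ip_norm _ _))//.
rewrite -[leRHS]mul1r ler_wpM2r// -(@ler_pXn2r _ 2)// ?nnegrE//.
by rewrite -(ipxx ip_norm) (orthonormal_unit oL eL) expr1n.
Qed.

End Projection.

(** * Compact self-adjoint operators with closed range have finite rank *)

Section FiniteRank.
Variables (R : realType) (H : completeNormedModType R).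
Variable ip : {dot H for (@idfun R)}.
Hypothesis ip_norm : inner_product_norm ip.

Definition orthonormal_sequence (e : nat -> H) :=
  forall i j, ip (e i) (e j) = (i == j)%:R.

Lemma ip_partial_sum (e : nat -> H) (a : nat -> R) n k :
  orthonormal_sequence e -> (k < n)%N ->
  ip (\sum_(0 <= i < n) a i *: e i) (e k) = a k.
Proof.
move=> oe kn; rewrite ip_suml (bigD1_seq k) ?mem_index_iota ?iota_uniq//=.
rewrite ipZl oe eqxx mulr1 big1 ?addr0// => i /negbTE ik.
by rewrite ipZl oe ik mulr0.
Qed.

(** Bessel's inequality for a bounded functional phi, obtained by evaluating
    phi at the vector x_n = sum_(i < n) phi (e i) e i, for which
    phi x_n = |x_n|^2 <= C |x_n|; it makes the series of the squares
    (phi (e i))^2 converge. *)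
Lemma orthonormal_weakly_cvg0 (e : nat -> H) :
  orthonormal_sequence e -> weakly_cvg e 0.
Proof.
move=> oe phi cphi; rewrite linear0.
have /linear_boundedP/pinfty_ex_gt0[C C0 phiC] : bounded_near phi (nbhs 0).
  by apply/linear_bounded_continuous.
pose x n := \sum_(0 <= i < n) phi (e i) *: e i.
pose s := series (fun i => phi (e i) ^+ 2).
have phix n : phi (x n) = s n.
  rewrite /x linear_sum; apply: eq_bigr => i _.
  by rewrite linearZ/= expr2.
have normx n : `|x n| ^+ 2 = s n.
  rewrite -(ipxx ip_norm) {2}/x ip_sumr /s /series/=.
  apply: eq_big_nat => i /andP[_ ik].
  by rewrite ipZr (ip_partial_sum _ oe ik) expr2.
have sC n : s n <= C ^+ 2.
  have := phiC (x n); rewrite phix -normx ger0_norm ?exprn_ge0//.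
  by have := normr_ge0 (x n); nra.
have /cvg_series_cvg_0 sq0 : cvgn s.
  apply: nondecreasing_is_cvgn.
    by apply: nondecreasing_series => n _ _; exact: sqr_ge0.
  by exists (C ^+ 2) => _ [n _ <-].
apply/cvgr0Pnorm_lt => eps eps0.
have /cvgr0_norm_lt/(_ (eps ^+ 2)) := sq0.
rewrite exprn_gt0// => /(_ isT); apply: filterS => n.
rewrite ger0_norm ?sqr_ge0// -[in X in X -> _]real_normK ?num_real//.
by rewrite ltr_pXn2r ?nnegrE// ltW.
Qed.

Section Operator.
Variable T : {linear H -> H}.
Hypothesis T_sa : self_adjoint ip T.
Hypothesis T_compact : compact_operator T.

(** Compactness only provides a limit l; it is 0 because, T being self-adjoint,
    |l|^2 is the limit of <T l, e n>, which tends to 0 by weak convergence. *)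
Lemma compact_orthonormal_cvg0 (e : nat -> H) :
  orthonormal_sequence e -> T (e n) @[n --> \oo] --> 0.
Proof.
move=> oe; have we := orthonormal_weakly_cvg0 oe.
have /cvg_ex[/= l Tel] := T_compact we.
suff l0 : ip l l = 0 by rewrite (ipxx_eq0 l0) in Tel.
pose phi : {linear H -> R} := ip (T l).
have cphi : continuous phi.
  by move=> x; apply: (cvg_ip ip_norm) => //; exact: cvg_cst.
have phi0 : phi (e n) @[n --> \oo] --> 0.
  by have := we phi cphi; rewrite linear0.
have phil : phi (e n) @[n --> \oo] --> ip l l.
  rewrite /phi/=; under eq_fun do rewrite T_sa.
  by apply: (cvg_ip ip_norm) => //; exact: cvg_cst.
exact: cvg_unique phil phi0.
Qed.

Hypothesis T_closed : closed (range T).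

(** Here T (e n) tends to 0, so the coefficients 2^-k of a suitable y in the
    range decay much more slowly than |T (e n)| along a subsequence, which no
    preimage of y allows. *)
Lemma no_orthonormal_sequence_in_range (e : nat -> H) :
  orthonormal_sequence e -> (forall n, range T (e n)) -> False.
Proof.
move=> oe eT.
have Te0 := compact_orthonormal_cvg0 oe.
have /choice[next nextP] : forall p : nat * nat, exists n,
    (p.2 < n)%N /\ `|T (e n)| <= 4^-1 ^+ p.1.
  move=> [k N]; have /cvgr0_norm_le/(_ (4^-1 ^+ k)) := Te0.
  rewrite exprn_gt0 ?invr_gt0// => /(_ isT)[N' _ N'P].
  exists (maxn N.+1 N'); split; first by rewrite leq_maxl.
  by apply: N'P; rewrite /= leq_maxr.
(* next is used with a lower bound on the index to make sigma increasing,
   hence to keep the extracted sequence orthonormal. *)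
pose sigma := fix sigma k :=
  if k is k'.+1 then next (k, sigma k') else next (0, 0)%N.
have sigma_lt : {homo sigma : i j / (i < j)%N}.
  by apply: homo_ltn => [|k]; [exact: ltn_trans|exact: (nextP (_, _)).1].
have Tsigma k : `|T (e (sigma k))| <= 4^-1 ^+ k.
  by case: k => [|k]; exact: (nextP (_, _)).2.
pose d k := e (sigma k).
have od : orthonormal_sequence d.
  move=> i j; rewrite /d oe; congr (_%:R); apply/eqP.
  case: (ltngtP i j) => [ij|ji|->]; last by rewrite eqxx.
  - by rewrite (ltn_eqF (sigma_lt _ _ ij)).
  - by rewrite (gtn_eqF (sigma_lt _ _ ji)).
pose u k := 2^-1 ^+ k *: d k.
have normd k : `|d k| = 1.
  by apply/eqP; rewrite -(@eqrXn2 _ 2)// -(ipxx ip_norm) od eqxx expr1n.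
have /normed_cvg/cvg_ex[/= y uy] : cvgn [normed series u].
  rewrite (_ : [normed series u] = series (geometric 1 2^-1)).
    by apply: is_cvg_geometric_series; rewrite ger0_norm; lra.
  congr series; apply/funext => k /=.
  by rewrite /u normrZ normd mulr1 mul1r ger0_norm// exprn_ge0// invr_ge0 ler0n.
have [z _ Tzy] : range T y.
  apply: (closed_cvg _ T_closed _ _ uy); apply: nearW => n.
  rewrite /series/=; elim/big_ind: _ => [|_ _ [a _ <-] [b _ <-]|k _].
  - by exists 0; rewrite ?linear0.
  - by exists (a + b); rewrite ?linearD.
  - have [a _ Ta] := eT (sigma k).
    by exists (2^-1 ^+ k *: a); rewrite // linearZ/= Ta.
have yd k : ip y (d k) = 2^-1 ^+ k.
  have : ip (series u n) (d k) @[n --> \oo] --> ip y (d k).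
    by apply: (cvg_ip ip_norm) => //; exact: cvg_cst.
  move/(cvg_unique _); apply => //; apply: cvg_near_cst.
  exists k.+1 => // n /= kn; exact: ip_partial_sum.
have zk k : 2 ^+ k <= `|z|.
  have := cauchy_schwarz ip_norm z (T (d k)).
  rewrite -T_sa Tzy yd ger0_norm ?exprn_ge0 ?invr_ge0// => le2.
  have := le_trans le2 (ler_wpM2l (normr_ge0 z) (Tsigma k)).
  rewrite (_ : 4^-1 = 2^-1 * 2^-1 :> R); last by field.
  rewrite exprMn mulrA -[leLHS]mul1r ler_pM2r ?exprn_gt0 ?invr_gt0// exprVn.
  by rewrite ler_pdivlMr ?mul1r ?exprn_gt0.
have := zk (Num.truncn `|z|).+1.
apply/negP; rewrite -ltNge.
rewrite (lt_le_trans (truncnS_gt _))// -natrX ler_nat.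
exact/ltnW/ltn_expl.
Qed.

(** If no finite orthonormal family of the range of T spanned it, the part of
    some T x orthogonal to any such family could be normalized and added to
    it, and iterating would give an orthonormal sequence in the range. *)
Lemma finite_rank :
  exists2 L, orthonormal ip L & forall x, proj ip L (T x) = T x.
Proof.
apply: contrapT => noL.
have ext L : exists e, orthonormal ip L -> (forall x, x \in L -> range T x) ->
    orthonormal ip (e :: L) /\ range T e.
  have [oL|] := pselect (orthonormal ip L); last by exists 0.
  have [LT|] := pselect (forall x, x \in L -> range T x); last by exists 0.
  have [x Lx] : exists x, T x - proj ip L (T x) != 0.
    apply: contrapT => Lx; apply: noL; exists L => // x.
    apply: contrapT => xL; apply: Lx; exists x.
    by rewrite subr_eq0; apply/eqP => /esym.
  have [oeL _] := orthonormal_extend ip_norm oL Lx.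
  eexists => _ _; split; first exact: oeL.
  have [a /esym aT] : exists a, T a = proj ip L (T x).
    rewrite /proj big_seq.
    elim/big_ind: _ => [|_ _ [a <-] [b <-]|e /LT[a _ <-]].
    - by exists 0; rewrite linear0.
    - by exists (a + b); rewrite linearD.
    - by exists (ip (T a) (T x) *: a); rewrite linearZ.
  set n := `|_|^-1; exists (n *: (x - a)) => //.
  by rewrite linearZ/= linearB aT.
have [next nextP] := choice ext.
pose L_ n := iter n (fun L => next L :: L) [::].
have LP n : orthonormal ip (L_ n) /\ (forall x, x \in L_ n -> range T x).
  elim: n => [//|n [oL LT]]; have [oL' LT'] := nextP _ oL LT; split=> //.
  by move=> x; rewrite inE => /predU1P[->|/LT].
pose e n := next (L_ n).
have oLS n : orthonormal ip (e n :: L_ n) by exact: (LP n.+1).1.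
have eL i j : (i < j)%N -> e i \in L_ j.
  elim: j => [//|j IH]; rewrite ltnS leq_eqVlt => /predU1P[->|/IH ij].
    exact: mem_head.
  by rewrite /= inE ij orbT.
apply: (@no_orthonormal_sequence_in_range e); last first.
  by move=> n; apply: (LP n.+1).2; exact: mem_head.
move=> i j; case: (ltngtP i j) => [/eL ij|/eL ji|->].
- by have [_ jL _] := oLS j; rewrite ipC jL.
- by have [_ iL _] := oLS i; rewrite iL.
- by have [] := oLS j.
Qed.

End Operator.
End FiniteRank.

(** * Quadratic functions along rays and asymptotic directions *)

Section Quadratic.
Variables (R : realType) (H : completeNormedModType R).
Variable ip : {dot H for (@idfun R)}.
Hypothesis ip_norm : inner_product_norm ip.

Definition quad (A : H -> H) (b : H) (x : H) : R := 2^-1 * ip x (A x) + ip b x.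

Lemma continuous_quad A b : continuous A -> continuous (quad A b).
Proof.
move=> cA x; apply: cvgD.
  by apply: cvgMr; apply: (cvg_ip ip_norm) => //; exact: cA.
by apply: (cvg_ip ip_norm) => //; exact: cvg_cst.
Qed.

Lemma quad_line (A : {linear H -> H}) b x v t : self_adjoint ip A ->
  quad A b (x + t *: v) =
    quad A b x + t * (ip x (A v) + ip b v) + t ^+ 2 * (2^-1 * ip v (A v)).
Proof.
move=> sA; rewrite /quad linearD linearZ/= !ipDl !ipDr !ipZl !ipZr.
by rewrite -(sA v x) (ipC ip (A v)); field.
Qed.

Lemma quad_proj (A : {linear H -> H}) b L x : self_adjoint ip A ->
  (forall z, proj ip L (A z) = A z) -> proj ip L b = b ->
  quad A b (proj ip L x) = quad A b x.
Proof.
move=> sA LA Lb; rewrite /quad ip_proj_sym LA -sA -ip_proj_sym LA sA.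
by rewrite -ip_proj_sym Lb.
Qed.

(** At the chosen t, which is at least 1, the product t a is the constant
    a - (|b| + |l|), so that t (b + t a) <= t (a - |l|) < - |l| <= l. *)
Lemma quadratic_lower_bound (a b l : R) :
  (forall t, 0 <= t -> l <= t * b + t ^+ 2 * a) -> 0 <= a.
Proof.
move=> h; rewrite leNgt; apply/negP => a0.
pose t := 1 + (`|b| + `|l|) / - a.
have q0 : 0 <= (`|b| + `|l|) / - a by rewrite divr_ge0 ?addr_ge0// oppr_ge0 ltW.
have ta : t * a = a - (`|b| + `|l|).
  by rewrite /t; field; rewrite lt_eqF.
have t1 : 1 <= t by rewrite lerDl.
have := h t (le_trans ler01 t1).
have := ler_norm b; have := ler_norm (- l); rewrite normrN.
by have := normr_ge0 l; nra.
Qed.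

Lemma affine_lower_bound (b l : R) :
  (forall t, 0 <= t -> l <= t * b) -> 0 <= b.
Proof.
move=> h; rewrite leNgt; apply/negP => b0.
have := h ((`|l| + 1) / - b).
rewrite divr_ge0 ?addr_ge0 ?oppr_ge0 ?(ltW b0)// => /(_ isT).
have -> : (`|l| + 1) / - b * b = - (`|l| + 1) by field; rewrite lt_eqF.
by have := ler_norm (- l); rewrite normrN; lra.
Qed.

(** The form of A stays nonnegative along the ray A v - t v, t >= 0, where it
    is affine of slope - 2 |A v|^2. *)
Lemma psd_isotropic_kernel (A : {linear H -> H}) v : self_adjoint ip A ->
  positive_semidefinite ip A -> ip v (A v) = 0 -> A v = 0.
Proof.
move=> sA pA vAv; apply: (ipxx_eq0 (ip := ip)); apply/eqP.
rewrite eq_le ipxx_ge0 andbT -oppr_ge0.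
apply: (@affine_lower_bound _ (- (2^-1 * ip (A v) (A (A v))))) => t t0.
have := pA (A v - t *: v).
rewrite [A (_ - _)]linearB [A (_ *: _)]linearZ/= !ipBl !ipBr !ipZl !ipZr.
by rewrite vAv -(sA v (A v)); nra.
Qed.

(** Asymptotic directions: v is the limit of the normalized vectors
    y k / |y k| of a sequence y whose norm tends to infinity. *)
Section AsymptoticDirection.
Variables (y : nat -> H) (v : H).
Hypothesis y_large : forall k, k.+1%:R < `|y k|.
Hypothesis y_dir : `|y k|^-1 *: y k @[k --> \oo] --> v.

Let u k := `|y k|^-1 *: y k.

Let norm_gt0 k : 0 < `|y k|.
Proof. exact: le_lt_trans (y_large k). Qed.

Let norm_scale k : y k = `|y k| *: u k.
Proof. by rewrite /u scalerA divff ?scale1r// gt_eqF. Qed.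

Let inv_norm_cvg0 : `|y k|^-1 @[k --> \oo] --> (0 : R).
Proof.
apply/gtr0_cvgV0; first by apply: nearW => k; exact: norm_gt0.
apply/cvgryPge => M; near=> k; apply: le_trans (ltW (y_large k)).
have Mk : (Num.truncn `|M| < k)%N by near: k; exact: nbhs_infty_gt.
rewrite (le_trans (ler_norm M))// (le_trans (ltW (truncnS_gt _)))//.
by rewrite ler_nat ltnS ltnW.
Unshelve. all: by end_near. Qed.

Let ip_dir_cvg b : ip b (u k) @[k --> \oo] --> ip b v.
Proof. by apply: (cvg_ip ip_norm) => //; exact: cvg_cst. Qed.

Lemma norm_dir : `|v| = 1.
Proof.
have h : `|u k| @[k --> \oo] --> `|v| by exact: cvg_norm.
suff h1 : `|u k| @[k --> \oo] --> (1 : R) by exact: cvg_unique h h1.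
apply: cvg_near_cst; apply: nearW => k /=.
by rewrite /u normrZ ger0_norm ?invr_ge0// mulVf// gt_eqF.
Qed.

(** Divide the bound at y k by |y k|^2 and let k tend to infinity. *)
Lemma quad_dir_le0 (A : {linear H -> H}) b B : continuous A ->
  (forall k, quad A b (y k) <= B) -> ip v (A v) <= 0.
Proof.
move=> cA yB.
have h : 2^-1 * ip (u k) (A (u k)) + `|y k|^-1 * ip b (u k)
    - `|y k|^-1 * `|y k|^-1 * B @[k --> \oo]
    --> 2^-1 * ip v (A v) + 0 * ip b v - 0 * 0 * B.
  apply: cvgB; last by apply: cvgMl; apply: cvgM.
  apply: cvgD; last exact: cvgM.
  apply: cvgMr; apply: (cvg_ip ip_norm) => //.
  by apply: cvg_comp y_dir _; exact: cA.
rewrite -(pmulr_rle0 _ (_ : 0 < 2^-1)) ?invr_gt0//.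
suff : 2^-1 * ip v (A v) + 0 * ip b v - 0 * 0 * B <= 0 by lra.
apply: (cvgr_to_le h); apply: nearW => k.
have := yB k; rewrite {1}norm_scale /quad; move: (u k) => w.
rewrite linearZ/= !ipZl !ipZr.
have := norm_gt0 k; set n := `|y k| => n0.
set p := ip _ _; set q := ip _ _ => pq.
have -> : 2^-1 * p + n^-1 * q - n^-1 * n^-1 * B =
    n^-1 ^+ 2 * (2^-1 * (n * (n * p)) + n * q - B).
  by field; rewrite gt_eqF.
by rewrite mulr_ge0_le0 ?exprn_ge0 ?invr_ge0 ?(ltW n0)// subr_le0.
Qed.

(** Drop the nonnegative quadratic part and divide by |y k|. *)
Lemma psd_quad_dir_le0 (A : {linear H -> H}) b B : positive_semidefinite ip A ->
  (forall k, quad A b (y k) <= B) -> ip b v <= 0.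
Proof.
move=> pA yB.
have h : ip b (u k) - `|y k|^-1 * B @[k --> \oo] --> ip b v - 0 * B.
  by apply: cvgB => //; exact: cvgMl.
suff : ip b v - 0 * B <= 0 by lra.
apply: (cvgr_to_le h); apply: nearW => k.
have q0 := pA (y k); have := norm_gt0 k; have := yB k.
rewrite /quad {3}norm_scale; move: (u k) => w; rewrite ipZr.
set n := `|y k|; set p := ip _ w => yBk n0.
have -> : p - n^-1 * B = n^-1 * (n * p - B) by field; rewrite gt_eqF.
by rewrite mulr_ge0_le0 ?invr_ge0 ?(ltW n0)//; lra.
Qed.

(** |y k - v|^2 = |y k|^2 - 2 |y k| <v, y k / |y k|> + 1, where the inner
    product tends to |v|^2 = 1 and |y k| > 1. *)
Lemma norm_sub_dir_lt : \forall k \near \oo, `|y k - v| < `|y k|.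
Proof.
have h : ip v (u k) @[k --> \oo] --> (1 : R).
  by rewrite -(expr1n _ 2) -norm_dir -(ipxx ip_norm).
have : \forall k \near \oo, 2^-1 < ip v (u k).
  by apply: (cvgr_gt _ h); lra.
apply: filterS => k vu.
rewrite -(@ltr_pXn2r _ 2)// ?nnegrE// -!(ipxx ip_norm) ipBl !ipBr.
rewrite (ipxx ip_norm v) norm_dir (ipC ip v (y k)).
have -> : ip (y k) v = `|y k| * ip v (u k) by rewrite {1}norm_scale ipZl ipC.
move: vu; set p := ip v _ => vu.
have := y_large k; have : (1 : R) <= k.+1%:R by rewrite ler1n.
by nra.
Qed.

(** An affine function that decreases along v tends to - oo along y. *)
Lemma affine_dir_le0 b (B : R) : ip b v < 0 ->
  \forall k \near \oo, ip b (y k) + B <= 0.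
Proof.
move=> bv; near=> k.
have -> : ip b (y k) = `|y k| * ip b (u k) by rewrite {1}norm_scale ipZr.
have bu : ip b (u k) <= 2^-1 * ip b v.
  by near: k; apply: (cvgr_le _ (@ip_dir_cvg b)); lra.
have : `|y k|^-1 * B <= - (2^-1 * ip b v).
  near: k.
  have hB : `|y k|^-1 * B @[k --> \oo] --> 0 * B by exact: cvgMl.
  by apply: (cvgr_le _ hB); rewrite mul0r; lra.
have n0 := norm_gt0 k.
have -> : `|y k| * ip b (u k) + B = `|y k| * (ip b (u k) + `|y k|^-1 * B).
  by field; rewrite gt_eqF.
by move=> nB; rewrite mulr_ge0_le0 ?(ltW n0)//; lra.
Unshelve. all: by end_near. Qed.

End AsymptoticDirection.
End Quadratic.

(** * Existence of minimizers *)

Section Minimization.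
Variables (R : realType) (H : completeNormedModType R).
Variable ip : {dot H for (@idfun R)}.
Hypothesis ip_norm : inner_product_norm ip.

(** A minimizer z of f over the part of F in the range of the projection and in
    a ball of radius at least r is not a global one, so some w in F has
    f w < f z; among the points of F at level at most f w, one of least norm x
    exists in the range, and it lies outside the ball because f x < f z. *)
Lemma far_least_norm_point (f : H -> R) (F : set H) (L : seq H) (x0 : H)
    (r : R) :
  orthonormal ip L -> continuous f -> closed F ->
  (forall x, f (proj ip L x) = f x) -> (forall x, F x -> F (proj ip L x)) ->
  F x0 -> ~ (exists2 xbar, F xbar & forall x, F x -> f xbar <= f x) ->
  exists x, [/\ F x, proj ip L x = x, f x <= f x0, r < `|x| &
    forall z, F z -> f z <= f x -> `|x| <= `|z|].
Proof.
move=> oL cf clF fL FL Fx0 nomin.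
pose ball r := [set x | proj ip L x = x /\ `|x| <= r].
have cball s : compact (ball s) by exact: compact_proj_ball.
have ballP s x : `|x| <= s -> ball s (proj ip L x).
  move=> xs; split; first exact: proj_idem.
  exact: le_trans (norm_proj_le _ _ _) xs.
(* |x0| enters the radius so that the ball meets F and f z <= f x0. *)
pose s := Num.max r `|x0|.
have [z zK zmin] : exists2 z, z \in F `&` ball s &
    forall x, x \in F `&` ball s -> f z <= f x.
  apply: compact_EVT_min.
  - exists (proj ip L x0); split; first exact: FL.
    by apply: ballP; rewrite le_max lexx orbT.
  - by rewrite setIC; apply: compact_closedI.
  - exact: continuous_subspaceT.
have [w Fw fwz] : exists2 w, F w & f w < f z.
  apply: contrapT => now; apply: nomin; exists z => [|x Fx].
    by move: zK; rewrite inE => -[].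
  by rewrite leNgt; apply/negP => fxz; apply: now; exists x.
pose S := F `&` [set x | f x <= f w].
have clS : closed S.
  apply: closedI => //.
  rewrite (_ : [set x | _] = f @^-1` [set y | y <= f w])//.
  by apply: preimage_closed; [move=> ? _; exact: cf|exact: closed_le].
have [x xK xmin] : exists2 x, x \in S `&` ball `|w| &
    forall y, y \in S `&` ball `|w| -> `|x| <= `|y|.
  apply: compact_EVT_min.
  - exists (proj ip L w); split; last exact: ballP.
    by split; [exact: FL|rewrite /= fL].
  - by rewrite setIC; apply: compact_closedI.
  - by apply: continuous_subspaceT => ?; exact: norm_continuous.
move: xK; rewrite inE => -[[Fx /= fxw] [Lx xw]].
exists x; split=> //.
- apply: le_trans fxw _; apply: le_trans (ltW fwz) _; rewrite -(fL x0).
  apply: zmin; rewrite inE; split; first exact: FL.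
  by apply: ballP; rewrite le_max lexx orbT.
- rewrite ltNge; apply/negP => xr.
  have : f z <= f x.
    by apply: zmin; rewrite inE; split=> //; split=> //; rewrite le_max xr.
  by rewrite leNgt (le_lt_trans fxw fwz).
- move=> y Fy fyx.
  have [yw|/ltW wy] := leP `|y| `|w|; last exact: le_trans xw wy.
  apply: le_trans (norm_proj_le ip_norm y oL).
  apply: xmin; rewrite inE; split; last exact: ballP.
  by split; [exact: FL|rewrite /= fL (le_trans fyx)].
Qed.

(** This form of sequential compactness lets a subsequence be picked by
    choice. *)
Lemma bounded_proj_sequence_cluster (L : seq H) (u : nat -> H) :
  orthonormal ip L -> (forall k, proj ip L (u k) = u k /\ `|u k| <= 1) ->
  exists v, forall k, exists2 n, (k <= n)%N & `|v - u n| < k.+1%:R^-1.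
Proof.
move=> oL uL.
have := compact_proj_ball (r := 1) ip_norm oL.
move=> /(_ (u @ \oo) _) [|v [_ vu]].
  by exists 0%N => // k _; exact: uL.
exists v => k.
have [] := vu (u @` [set n | (k <= n)%N]) (ball v k.+1%:R^-1).
- by exists k => // n /= kn; exists n.
- by apply: nbhsx_ballx; rewrite invr_gt0.
- by move=> _ [[n kn <-]]; rewrite -ball_normE/=; exists n.
Qed.

Variables (m : nat) (T : {linear H -> H}) (T_ : 'I_m -> {linear H -> H}).
Variables (c : H) (c_ : 'I_m -> H) (alpha : 'I_m -> R).
Hypothesis T_cont : continuous T.
Hypothesis T_sa : self_adjoint ip T.
Hypothesis T__cont : forall i, continuous (T_ i).
Hypothesis T__sa : forall i, self_adjoint ip (T_ i).
Hypothesis T__psd : forall i, positive_semidefinite ip (T_ i).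

Let f := quad ip T c.
Let F := [set x | forall i, quad ip (T_ i) (c_ i) x + alpha i <= 0].

Lemma recession_of_kernel v : (forall i, T_ i v = 0) ->
  (forall i, ip (c_ i) v <= 0) -> recession_cone F v.
Proof.
move=> Tv cv x Fx t t0 i.
rewrite (quad_line _ _ _ _ (T__sa i)) Tv !ip0r add0r !mulr0 addr0.
by have := Fx i; have := cv i; nra.
Qed.

(** On the ray from x in direction v, f is a polynomial of degree 2 in t >= 0
    that is bounded below: its leading coefficient is nonnegative, and when it
    vanishes so is the slope. *)
Lemma bounded_below_recession v x : has_lbound (f @` F) -> F x ->
  recession_cone F v -> ip v (T v) <= 0 ->
  ip v (T v) = 0 /\ 0 <= ip x (T v) + ip c v.
Proof.
move=> [l fl] Fx Fv vTv.
have ray t : 0 <= t -> l - f x <=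
    t * (ip x (T v) + ip c v) + t ^+ 2 * (2^-1 * ip v (T v)).
  move=> t0; have := fl (f (x + t *: v)).
  rewrite /f quad_line// -addrA -lerBlDl.
  by apply; exists (x + t *: v); [exact: Fv|rewrite quad_line// addrA].
have v0 : ip v (T v) = 0.
  by apply/eqP; rewrite eq_le vTv /=; have := quadratic_lower_bound ray; lra.
split=> //; apply: (@affine_lower_bound _ _ (l - f x)) => t /ray.
by rewrite v0 !mulr0 addr0.
Qed.

Hypothesis hA : condition_A ip T F T_ c_.
Hypothesis f_bounded : has_lbound (f @` F).

(** The step y k - v goes against a recession direction, so f does not
    increase along it by the sign of its slope; condition (A) is what makes the
    step feasible for the constraints that are not affine. *)
Lemma escaping_sequence_descends (y : nat -> H) (v : H) (B : R) :
  (forall k, F (y k)) -> (forall k, f (y k) <= B) ->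
  (forall k, k.+1%:R < `|y k|) -> `|y k|^-1 *: y k @[k --> \oo] --> v ->
  exists k, [/\ F (y k - v), f (y k - v) <= f (y k) & `|y k - v| < `|y k|].
Proof.
move=> Fy fB y_large y_dir.
have gy i k : quad ip (T_ i) (c_ i) (y k) <= - alpha i.
  by rewrite -subr_le0 opprK; exact: Fy.
have Tiv i : T_ i v = 0.
  apply: (psd_isotropic_kernel (T__sa i) (T__psd i)); apply/eqP.
  rewrite eq_le (T__psd i v) andbT.
  exact: (quad_dir_le0 ip_norm y_large y_dir (@T__cont i) (gy i)).
have civ i : ip (c_ i) v <= 0.
  exact: (psd_quad_dir_le0 ip_norm y_large y_dir (T__psd i) (gy i)).
have Fv : recession_cone F v by exact: recession_of_kernel.
have vTv_le0 := quad_dir_le0 ip_norm y_large y_dir T_cont fB.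
have descent k : f (y k - v) <= f (y k).
  have [vTv slope] := bounded_below_recession f_bounded (Fy k) Fv vTv_le0.
  rewrite -[- v]scaleN1r /f quad_line// vTv !mulr0 addr0.
  by rewrite mulN1r gerDl oppr_le0.
have [vTv _] := bounded_below_recession f_bounded (Fy 0%N) Fv vTv_le0.
have gyv i k : quad ip (T_ i) (c_ i) (y k - v) =
    quad ip (T_ i) (c_ i) (y k) - ip (c_ i) v.
  rewrite -[- v]scaleN1r (quad_line _ _ _ _ (T__sa i)) Tiv !ip0r.
  by rewrite add0r !mulr0 addr0 mulN1r.
have near_feasible : \forall k \near \oo, F (y k - v).
  apply: filter_forall => i.
  have := civ i; rewrite le_eqVlt => /predU1P[civ0|civ_lt0].
    by apply: nearW => k; rewrite gyv civ0 subr0; exact: Fy.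
  (* <c_i, v> < 0 and condition (A) force T_i = 0: the constraint is affine. *)
  have Ti0 x : T_ i x = 0.
    have [->//|Ti_neq0] := pselect (T_ i = \0 :> (H -> H)).
    by move: civ_lt0; rewrite (hA Fv vTv Ti_neq0) ltxx.
  have := affine_dir_le0 ip_norm y_large y_dir (alpha i - ip (c_ i) v) civ_lt0.
  apply: filterS => k; rewrite gyv /quad Ti0 ip0r mulr0 add0r.
  by rewrite addrA addrAC.
have [k [Fk normk]] := filter_ex
  (filterI near_feasible (norm_sub_dir_lt ip_norm y_large y_dir)).
by exists k.
Qed.

Hypothesis T_compact : compact_operator T.
Hypothesis T_closed : closed (range T).
Hypothesis T__compact : forall i, compact_operator (T_ i).
Hypothesis T__closed : forall i, closed (range (T_ i)).

Lemma common_finite_dimensional_support : exists L,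
  [/\ orthonormal ip L, forall x, f (proj ip L x) = f x &
    forall x, F x -> F (proj ip L x)].
Proof.
have [LT _ LTP] := finite_rank ip_norm T_sa T_compact T_closed.
have /choice[LTi LTiP] i : exists L, forall x, proj ip L (T_ i x) = T_ i x.
  have [L _ LP] := finite_rank ip_norm (T__sa i) (@T__compact i) (@T__closed i).
  by exists L.
have [L oL LP] := gram_schmidt ip_norm
  (c :: LT ++ [seq c_ i | i : 'I_m] ++ flatten [seq LTi i | i : 'I_m]).
exists L; split=> // [x|x Fx i].
  apply: quad_proj => // [z|]; last by apply: LP; rewrite mem_head.
  rewrite -(LTP z) proj_fixed// => e eL; apply: LP.
  by rewrite inE mem_cat eL orbT.
rewrite quad_proj; [exact: Fx|exact: T__sa|move=> z|].
  rewrite -(LTiP i z) proj_fixed// => e eL; apply: LP.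
  rewrite inE !mem_cat; apply/or4P/Or44/flattenP.
  by exists (LTi i) => //; apply: map_f; rewrite mem_enum.
apply: LP; rewrite inE !mem_cat; apply/or4P/Or43.
by apply: map_f; rewrite mem_enum.
Qed.

Lemma closed_feasible : closed F.
Proof.
rewrite (_ : F = \bigcap_i
    (fun x => quad ip (T_ i) (c_ i) x + alpha i) @^-1` [set y | y <= 0]).
  apply: closed_bigI => i _; apply: preimage_closed; last exact: closed_le.
  move=> x _; apply: cvgD; last exact: cvg_cst.
  exact: (continuous_quad ip_norm (@T__cont i)).
by apply/seteqP; split=> x Fx i; [move=> _; exact: Fx|exact: Fx].
Qed.

Lemma quadratic_program_attained : F !=set0 ->
  exists2 xbar, F xbar & forall x, F x -> f xbar <= f x.
Proof.
move=> [x0 Fx0]; apply: contrapT => nomin.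
have [L [oL fL FL]] := common_finite_dimensional_support.
have cf : continuous f by exact: continuous_quad.
have /choice[x xP] k := far_least_norm_point k.+1%:R oL cf closed_feasible
  fL FL Fx0 nomin.
have x_gt0 n : 0 < `|x n|.
  by have [_ _ _ xn _] := xP n; exact: le_lt_trans xn.
have [v vP] : exists v, forall k, exists2 n, (k <= n)%N &
    `|v - `|x n|^-1 *: x n| < k.+1%:R^-1.
  apply: bounded_proj_sequence_cluster oL _ => n.
  have [_ Lx _ _ _] := xP n; split.
    have := proj_sum ip L [:: x n] (fun=> `|x n|^-1) id.
    by rewrite !big_seq1 Lx.
  by rewrite normrZ ger0_norm ?invr_ge0// mulVf// gt_eqF.
have /choice[sigma sigmaP] k : exists n, (k <= n)%N /\
    `|v - `|x n|^-1 *: x n| < k.+1%:R^-1.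
  by have [n] := vP k; exists n.
pose y k := x (sigma k).
have yP k : [/\ F (y k), f (y k) <= f x0, k.+1%:R < `|y k| &
    forall z, F z -> f z <= f (y k) -> `|y k| <= `|z|].
  have [Fy _ fy ny ymin] := xP (sigma k); split=> //.
  by apply: le_lt_trans ny; rewrite ler_nat ltnS (sigmaP k).1.
have y_dir : `|y k|^-1 *: y k @[k --> \oo] --> v.
  apply/cvgrPdist_lt => _/posnumP[e]; have := near_infty_natSinv_lt e.
  apply: filterS => k /=.
  exact: lt_trans (sigmaP k).2.
have [k [Fk fk nk]] : exists k, [/\ F (y k - v), f (y k - v) <= f (y k) &
    `|y k - v| < `|y k|].
  apply: (@escaping_sequence_descends y v (f x0)) => // k.
  - by have [] := yP k.
  - by have [] := yP k.
  - by have [] := yP k.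
have [_ _ _ /(_ _ Fk fk)] := yP k.
by rewrite leNgt nk.
Qed.

End Minimization.

Theorem theorem3p4 (R : realType) (H : completeNormedModType R)
  (ip : {dot H for (@idfun R)}) (ip_norm : inner_product_norm ip)
  (m : nat) (m_gt0 : (0 < m)%N)
  (T : {linear H -> H}) (T_cont : continuous T) (T_sa : self_adjoint ip T)
  (T_ : 'I_m -> {linear H -> H}) (T__cont : forall i, continuous (T_ i))
  (T__sa : forall i, self_adjoint ip (T_ i))
  (T__psd : forall i, positive_semidefinite ip (T_ i))
  (c : H) (c_ : 'I_m -> H) (alpha : 'I_m -> R)
  (f := fun x : H => 2^-1 * ip x (T x) + ip c x)
  (g := fun i (x : H) => 2^-1 * ip x (T_ i x) + ip (c_ i) x + alpha i)
  (F := [set x | forall i, g i x <= 0])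
  (T_compact : compact_operator T) (T_closed : closed (range T))
  (T__compact : forall i, compact_operator (T_ i))
  (T__closed : forall i, closed (range (T_ i)))
  (F_neq0 : F !=set0) (f_bounded : has_lbound (f @` F))
  (hA : condition_A ip T F T_ c_) :
  exists2 xbar, F xbar & forall x, F x -> f xbar <= f x.
Proof.
exact: (quadratic_program_attained ip_norm T_cont T_sa T__cont T__sa T__psd hA
  f_bounded T_compact T_closed T__compact T__closed F_neq0).
Qed.
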